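(* Let $n\ge1$, let $a_0,\dots,a_n$ and $x$ be real numbers, let $P(x)=\sum_{i=0}^n a_ix^i$ and assume $P(x)\ne0$. Let $\widehat P(x)=\widehat r_{2n}$ be the value computed by Horner's rule under SR-nearness with $u=\beta^{1-p}$: $\widehat r_0=a_n$ and, for $1\le k\le n$, $$\widehat r_{2k-1}=\widehat r_{2k-2}\,x\,(1+\delta_{2k-1}),\qquad \widehat r_{2k}=(\widehat r_{2k-1}+a_{n-k})(1+\delta_{2k}),$$ where $\delta_{2k-1},\delta_{2k}$ are the SR-nearness relative errors of the product and of the addition. Then for every $0<\lambda<1$, $$\mathbb P\left(\frac{|\widehat P(x)-P(x)|}{|P(x)|}\le\mathcal K_1\sqrt{\gamma_{2n}(u^2)/\lambda}\right)\ge1-\lambda,$$ where $\mathcal K_1=\dfrac{\sum_{i=0}^n|a_ix^i|}{|P(x)|}$ and $\gamma_{2n}(u^2)=(1+u^2)^{2n}-1$.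
   Context: Floating-point numbers: fix a base $\beta\ge2$ and precision $p\ge1$ (integers); $\mathcal F$ is the set of normal floating-point numbers $\pm m\beta^{e-p}$ with $m,e$ integers and $\beta^{p-1}\le m<\beta^p$ (underflow and overflow are ignored, so $e$ ranges over all integers). Put $u=\beta^{1-p}$. For real $x\ne0$, $\lceil x\rceil=\min\{y\in\mathcal F:y\ge x\}$, $\lfloor x\rfloor=\max\{y\in\mathcal F:y\le x\}$, and, for $x\notin\mathcal F$, $\theta(x)=(x-\lfloor x\rfloor)/(\lceil x\rceil-\lfloor x\rfloor)$. SR-nearness (stochastic rounding): for $x\notin\mathcal F\cup\{0\}$, $\mathrm{fl}(x)=\lceil x\rceil$ with probability $\theta(x)$ and $\mathrm{fl}(x)=\lfloor x\rfloor$ with probability $1-\theta(x)$; if $x\in\mathcal F\cup\{0\}$, $\mathrm{fl}(x)=x$. In a sequence of elementary operations $c_k\leftarrow a_k\,\mathrm{op}_k\,b_k$, $\mathrm{op}_k\in\{+,-,*,/\}$, whose operands are data or previously computed values, each rounding is made with these probabilities conditionally on all previous roundings. The relative error $\delta_k$ of the $k$th operation is defined by $\widehat c_k=\mathrm{fl}(\widehat a_k\,\mathrm{op}_k\,\widehat b_k)=(\widehat a_k\,\mathrm{op}_k\,\widehat b_k)(1+\delta_k)$, with $\delta_k=0$ when the exact result is $0$. It is known that $|\delta_k|\le u$ and $\mathbb{E}[\delta_k\mid\delta_1,\dots,\delta_{k-1}]=\mathbb{E}(\delta_k)=0$ for all $k$ (mean independence). Here the operations are performed in the order of the indices $1,2,\dots,2n$,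 and input data are used exactly. *)

(* Defs.v *)
From HB Require Import structures.
From mathcomp Require Import all_boot all_order all_algebra.
From mathcomp Require Import all_classical all_reals all_analysis.
Set Implicit Arguments.
Unset Strict Implicit.
Unset Printing Implicit Defensive.
Import Order.TTheory GRing.Theory Num.Theory.
Local Open Scope classical_set_scope.
Local Open Scope ring_scope.

(* Normal floating-point numbers in base [beta] with precision [p] and
   unbounded exponent; the mantissa is nonzero, so 0 is not in this set. *)
Definition float_set {R : realType} (beta p : nat) : set R :=
  [set y | exists (s : bool) (m : nat) (e : int),
     (beta ^ (p - 1) <= m < beta ^ p)%N /\
     y = (-1) ^+ s * m%:R * (beta%:R : R) ^ (e - p%:Z)].

Definition roundoff {R : realType} (beta p : nat) : R :=
  (beta%:R : R) ^ (1 - p%:Z).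

(* Minimum and maximum of a set of reals, with value 0 when there is none. *)
Definition set_min {R : realType} (A : set R) : R := xget 0 (A `&` lbound A).
Definition set_max {R : realType} (A : set R) : R := xget 0 (A `&` ubound A).

(* For y != 0 the minimum and the maximum below exist. *)
Definition float_up {R : realType} (beta p : nat) (y : R) : R :=
  set_min [set z | float_set beta p z /\ y <= z].
Definition float_down {R : realType} (beta p : nat) (y : R) : R :=
  set_max [set z | float_set beta p z /\ z <= y].

Definition theta {R : realType} (beta p : nat) (y : R) : R :=
  (y - float_down beta p y) / (float_up beta p y - float_down beta p y).

(* Probability that SR-nearness rounds the real number y to the value v. *)
Definition sr_mass {R : realType} (beta p : nat) (y v : R) : R :=
  if `[< float_set beta p y \/ y = 0 >] then (v == y)%:R
  else theta beta p y * (v == float_up beta p y)%:R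
       + (1 - theta beta p y) * (v == float_down beta p y)%:R.

(* [c k] is the exact result of the [k]-th operation on its computed operands
   and [delta k] its relative error, so that the computed value is
   [c k * (1 + delta k)].  A computation reaches finitely many values with
   positive probability, so conditioning on the previous roundings is
   elementary conditioning on their values [h 1, ..., h (k - 1)]; the
   conditional probabilities are written multiplicatively, which also covers
   histories of probability zero. *)
Definition SR_nearness_errors {R : realType} {d : measure_display}
    {T : measurableType d} (P : probability T R) (beta p N : nat)
    (c delta : nat -> T -> R) : Prop :=
  let fl k w := c k w * (1 + delta k w) in
  forall k : nat, (1 <= k <= N)%N ->
    (forall w, c k w = 0 -> delta k w = 0) /\
    (forall (h : nat -> R) (y v : R),
       let H := [set w | (forall j, (1 <= j < k)%N -> fl j w = h j) /\
                         c k w = y] in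
       P (H `&` [set w | fl k w = v]) = ((sr_mass beta p y v)%:E * P H)%E).

(* Operation [k] of Horner's rule, applied to the computed values [r]:
   the products have odd indices, the additions even ones. *)
Definition horner_exact {R : realType} {T : Type} (n : nat) (a : nat -> R)
    (x : R) (r : nat -> T -> R) (k : nat) (w : T) : R :=
  if odd k then r (k - 1)%N w * x else r (k - 1)%N w + a (n - k./2)%N.

Definition gamma_ {R : realType} (m : nat) (t : R) : R := (1 + t) ^+ m - 1.

(* Main.v *)
Require Import Defs.
From HB Require Import structures.
From mathcomp Require Import all_boot all_order all_algebra.
From mathcomp Require Import all_classical all_reals all_analysis.
From mathcomp Require Import ring lra.
Set Implicit Arguments.
Unset Strict Implicit.
Unset Printing Implicit Defensive.
Import Order.TTheory GRing.Theory Num.Theory.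
Local Open Scope classical_set_scope.
Local Open Scope ring_scope.

(** Let s_k be the exact Horner values, S_k those of the polynomial with
    coefficients |a_i| at |x|, and q_k = x or 1 according to the parity of k.
    Given the past, the rounded value r_k has mean c_k and variance at most
    u^2 c_k^2, while c_k - s_k = q_k (r_{k-1} - s_{k-1}).  Hence r_k has mean
    s_k and its variance satisfies V_k <= (1 + u^2) q_k^2 V_{k-1} + u^2 s_k^2; since
    |s_k| <= S_k and |q_k| S_{k-1} <= S_k, induction gives
    V_k <= S_k^2 ((1 + u^2)^k - 1), and Chebyshev's inequality concludes.
    All computed values have finite support, so expectations are finite sums. *)

(** * Consecutive floating-point numbers, and the mean and variance of one stochastic rounding *)

Section StochasticRounding.
Context {R : realType} (beta p : nat).
Hypotheses (hbeta : (2 <= beta)%N) (hp : (1 <= p)%N).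
Implicit Types (y z l h : R) (g : R -> R).

Let B : R := beta%:R.
Let u : R := roundoff beta p.

Let B_gt1 : 1 < B. Proof. by rewrite /B ltr1n. Qed.
Let B_gt0 : 0 < B. Proof. exact: lt_trans B_gt1. Qed.
Let B_neq0 : B != 0. Proof. by rewrite gt_eqF. Qed.

Lemma roundoff_gt0 : 0 < u.
Proof. exact: exprz_gt0. Qed.

Lemma exprz_bracket y : 0 < y -> exists e : int, B ^ (e - 1) <= y < B ^ e.
Proof.
move=> y_gt0.
have exp_gt z : 0 < z -> exists n : nat, z < B ^ n%:Z.
  move=> z_gt0; exists (Num.Def.archi_bound z).
  apply: lt_trans (archi_boundP (ltW z_gt0)) _.
  by rewrite -exprnP /B -natrX ltr_nat ltn_expl.
have [|M hM] := exp_gt y^-1; first by rewrite invr_gt0.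
(* Exponents are shifted by [M] so that the least one can be sought among natural numbers; the
   shifted exponent 0 is excluded since [B ^ (- M) < y]. *)
have exN : exists n : nat, y < B ^ (n%:Z - M%:Z).
  have [n hn] := exp_gt _ y_gt0; exists (n + M)%N.
  by rewrite PoszD addrK.
case: (ex_minnP exN) => -[|n] hn nmin.
  move: hn; rewrite sub0r -invr_expz => hn; exfalso.
  have hM' : (B ^ M%:Z)^-1 < y by rewrite invf_plt ?posrE ?exprz_gt0.
  by have := lt_trans hn hM'; rewrite ltxx.
exists (n.+1%:Z - M%:Z); rewrite hn andbT leNgt; apply/negP => h.
have /nmin : y < B ^ (n%:Z - M%:Z); last by rewrite ltnn.
suff -> : n%:Z - M%:Z = n.+1%:Z - M%:Z - 1 by [].
by rewrite -[in RHS]addn1 PoszD; ring.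
Qed.

(** Characterises the two neighbours of [y] without [set_min] and [set_max], in a form symmetric
    under negation, so that only positive [y] needs a construction. The last clause is the source of
    the factor [u ^ 2] in the variance. *)
Definition float_bracket y l h : Prop :=
  [/\ float_set beta p l, float_set beta p h, l <= y <= h,
     (forall z, float_set beta p z -> ~~ (l < z < h)) & h - l <= u * `|y|].

Lemma float_setN z : float_set beta p z -> float_set beta p (- z).
Proof.
move=> [s [m [e [hm ->]]]]; exists (~~ s), m, e; split => //.
by rewrite signrN !mulNr.
Qed.

Lemma float_bracketN y l h :
  float_bracket y l h -> float_bracket (- y) (- h) (- l).
Proof.
move=> [Fl Fh /andP[ly yh] gap hl]; split; try exact: float_setN.
- by rewrite !lerN2 yh ly.
- move=> z /float_setN /gap; apply: contra => /andP[hz zl].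
  by rewrite ltrNr zl ltrNl hz.
- by rewrite normrN opprK addrC.
Qed.

(** If [B ^ (e - 1) <= y < B ^ e], the floats around [y] have spacing [b = B ^ (e - p)], so the
    neighbours are the multiples of [b] obtained by truncating [y / b] and adding one. *)
Lemma float_bracket_pos y : 0 < y -> exists l h, float_bracket y l h.
Proof.
move=> y_gt0; have [e /andP[ey ye]] := exprz_bracket y_gt0.
set b := B ^ (e - p%:Z).
have b_gt0 : 0 < b by exact: exprz_gt0.
have expB (k : nat) : B ^ k%:Z * b = B ^ (e - p%:Z + k%:Z).
  by rewrite /b [RHS]expfzDr// mulrC.
have Ep : (beta ^ p)%:R * b = B ^ e.
  by rewrite natrX -/B exprnP expB subrK.
have Ep1 : (beta ^ (p - 1))%:R * b = B ^ (e - 1).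
  rewrite natrX -/B exprnP expB -subzn//; congr (B ^ _); ring.
have yb_ge0 : 0 <= y / b by rewrite divr_ge0 ?ltW.
set m := Num.Def.trunc (y / b).
have /andP[my ym] := truncn_itv yb_ge0; rewrite -/m in my ym.
rewrite ler_pdivlMr// in my; rewrite ltr_pdivrMr// in ym.
have m_lt : (m < beta ^ p)%N.
  by rewrite -(ltr_nat R) -(ltr_pM2r b_gt0) Ep (le_lt_trans my).
have m_ge : (beta ^ (p - 1) <= m)%N.
  by rewrite -ltnS -(ltr_nat R) -(ltr_pM2r b_gt0) Ep1 (le_lt_trans ey).
exists (m%:R * b), (m.+1%:R * b); split.
- by exists false, m, e; rewrite m_ge m_lt mul1r.
- case: (ltngtP m.+1 (beta ^ p)%N) => [h|h|h].
  + by exists false, m.+1, e; rewrite h (leq_trans m_ge)// mul1r.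
  + by move: m_lt; rewrite ltnNge -ltnS h.
  (* The mantissa overflows: the upper neighbour is [B ^ e], which is written with the least
     mantissa and the next exponent. *)
  + exists false, (beta ^ (p - 1))%N, (e + 1).
    rewrite leqnn ltn_exp2l// ltn_subrL hp; split => //.
    rewrite h Ep mul1r natrX -/B exprnP -expfzDr// -subzn//.
    by congr (B ^ _); ring.
- by rewrite my ltW.
- move=> z [s [k [e' [/andP[k_ge k_lt] ->]]]]; apply/negP => /andP[].
  case: s; rewrite ?mulN1r ?mulNr ?mul1r.
    move=> + _; apply/negP; rewrite -leNgt (@le_trans _ _ 0)//.
      by rewrite oppr_le0 mulr_ge0// ltW// exprz_gt0.
    by rewrite mulr_ge0// ltW.
  (* A positive float of exponent at least [e] is an integer multiple of [b], so it cannot lie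
     strictly between two consecutive multiples; one of smaller exponent is below [B ^ (e - 1)],
     hence at most the lower neighbour. *)
  have [ee'|e'e] := leP e e'.
    have [j ej] : exists j : nat, e' - e = j%:Z.
      by exists `|e' - e|%N; rewrite gez0_abs// subr_ge0.
    have -> : B ^ (e' - p%:Z) = (beta ^ j)%:R * b.
      by rewrite natrX -/B exprnP expB -ej; congr (B ^ _); ring.
    rewrite mulrA -natrM !ltr_pM2r// !ltr_nat ltnS => h1.
    by rewrite leqNgt h1.
  move=> + _; apply/negP; rewrite -leNgt.
  apply: (@le_trans _ _ (B ^ e')); last first.
    apply: le_trans (_ : B ^ (e - 1) <= _).
      by apply: ler_weXz2l; [exact: ltW|rewrite lerBrDr lezD1].
    by rewrite -Ep1 ler_pM2r// ler_nat.
  apply: le_trans (_ : (beta ^ p)%:R * B ^ (e' - p%:Z) <= _).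
    by rewrite ler_pM2r ?exprz_gt0// ler_nat ltnW.
  by rewrite natrX -/B exprnP -expfzDr// addrC subrK.
(* The gap is [b = u * B ^ (e - 1)], and [B ^ (e - 1) <= y]. *)
- rewrite -mulrBl -natrB// subSnn mul1r gtr0_norm//.
  apply: le_trans (_ : u * B ^ (e - 1) <= _); last first.
    by rewrite ler_pM2l// roundoff_gt0.
  rewrite /u /roundoff -/B -expfzDr// /b.
  by rewrite (_ : 1 - _ + _ = e - p%:Z)//; ring.
Qed.

Lemma float_bracket_ex y : y != 0 -> exists l h, float_bracket y l h.
Proof.
rewrite neq_lt => /orP[y_lt0|]; last exact: float_bracket_pos.
have [|l [h hb]] := @float_bracket_pos (- y); first by rewrite oppr_gt0.
by exists (- h), (- l); rewrite -[y]opprK; exact: float_bracketN.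
Qed.

Lemma float_bracket_up y l h :
  float_bracket y l h -> ~ float_set beta p y -> float_up beta p y = h.
Proof.
move=> [Fl Fh /andP[ly yh] gap _] NFy; rewrite /float_up /set_min.
have y_neq z : float_set beta p z -> z != y.
  by move=> Fz; apply/eqP => zy; rewrite zy in Fz.
have minh : ([set z | float_set beta p z /\ y <= z] `&`
             lbound [set z | float_set beta p z /\ y <= z]) h.
  split=> //= z /= [Fz yz]; rewrite leNgt; apply/negP => zh.
  have /negP := gap _ Fz; apply.
  by rewrite zh (lt_le_trans _ yz)// lt_neqAle y_neq.
(* Since [h] is a minimum, the default value 0 of [xget] is not taken, and two minima coincide by
   antisymmetry. *)
have [[Fup yup] lbup] := xgetPex 0 (ex_intro _ h minh).
apply/eqP; rewrite eq_le; apply/andP; split; first exact: lbup.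
by apply: (minh.2).
Qed.

Lemma float_bracket_down y l h :
  float_bracket y l h -> ~ float_set beta p y -> float_down beta p y = l.
Proof.
move=> [Fl Fh /andP[ly yh] gap _] NFy; rewrite /float_down /set_max.
have y_neq z : float_set beta p z -> z != y.
  by move=> Fz; apply/eqP => zy; rewrite zy in Fz.
have maxl : ([set z | float_set beta p z /\ z <= y] `&`
             ubound [set z | float_set beta p z /\ z <= y]) l.
  split=> //= z /= [Fz zy]; rewrite leNgt; apply/negP => lz.
  have /negP := gap _ Fz; apply; rewrite lz (le_lt_trans zy)// lt_neqAle yh.
  by rewrite eq_sym y_neq.
have [[Fdn dny] ubdn] := xgetPex 0 (ex_intro _ l maxl).
apply/eqP; rewrite eq_le; apply/andP; split; last exact: ubdn.
by apply: (maxl.2).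
Qed.

Definition sr_mean y g : R :=
  if `[< float_set beta p y \/ y = 0 >] then g y
  else theta beta p y * g (float_up beta p y)
       + (1 - theta beta p y) * g (float_down beta p y).

Lemma sum_sr_mass y g (L : seq R) : uniq L ->
  {subset [:: y; float_up beta p y; float_down beta p y] <= L} ->
  \sum_(v <- L) sr_mass beta p y v * g v = sr_mean y g.
Proof.
move=> uL sL.
have pick z : z \in L -> \sum_(v <- L) (v == z)%:R * g v = g z.
  move=> zL; rewrite (bigD1_seq z)//= eqxx mul1r big1 ?addr0// => v /negPf ->.
  by rewrite mul0r.
rewrite /sr_mass /sr_mean; case: ifP => _.
  by apply/pick/sL; rewrite inE eqxx.
under eq_bigr do rewrite mulrDl -!mulrA.
rewrite big_split/= -!mulr_sumr !pick ?mulrA//.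
all: by apply: sL; rewrite !inE eqxx ?orbT.
Qed.

Lemma sr_mean_cst y (t : R) : sr_mean y (fun=> t) = t.
Proof. by rewrite /sr_mean; case: ifP => // _; ring. Qed.

(** Rounding is unbiased: [theta] is the weight that makes [y] the barycentre of its two
    neighbours. *)
Lemma sr_mean_sub y (s : R) : sr_mean y (fun v => v - s) = y - s.
Proof.
rewrite /sr_mean; case: ifPn => // /asboolPn /not_orP[NFy /eqP y0].
have [l [h hb]] := float_bracket_ex y0.
rewrite /theta (float_bracket_up hb)// (float_bracket_down hb)//.
have [Fl Fh /andP[ly yh] _ _] := hb.
have lh : h - l != 0.
  rewrite subr_eq0; apply/eqP => hl; apply: NFy.
  by rewrite (_ : y = l)//; apply/le_anti; rewrite ly andbT -hl.
by field.
Qed.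

(** Squared bias plus variance: the two-point law on [l], [h] with mean [y] has variance
    [(h - y) * (y - l)], and both factors are at most [h - l <= u * |y|]. *)
Lemma sr_mean_sqr_sub y (s : R) :
  sr_mean y (fun v => (v - s) ^+ 2) <= (y - s) ^+ 2 + u ^+ 2 * y ^+ 2.
Proof.
rewrite /sr_mean; case: ifPn => [_|/asboolPn /not_orP[NFy /eqP y0]].
  by rewrite lerDl mulr_ge0// sqr_ge0.
have [l [h hb]] := float_bracket_ex y0.
rewrite /theta (float_bracket_up hb)// (float_bracket_down hb)//.
have [Fl Fh /andP[ly yh] _ hl] := hb.
have lh : h - l != 0.
  rewrite subr_eq0; apply/eqP => hl'; apply: NFy.
  by rewrite (_ : y = l)//; apply/le_anti; rewrite ly andbT -hl'.
rewrite [leLHS](_ : _ = (y - s) ^+ 2 + (h - y) * (y - l)); last by field.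
rewrite lerD2l -(real_normK (num_real y)) -exprMn.
apply: le_trans (_ : (h - l) ^+ 2 <= _).
  rewrite expr2; apply: ler_pM; rewrite ?subr_ge0//; lra.
by rewrite lerXn2r// ?nnegrE; lra.
Qed.

End StochasticRounding.

(** * Random variables with finite support: Chebyshev's inequality and propagation of moments
    through a rounding *)

Section FiniteLaws.
Context {R : realType} {d : measure_display} {T : measurableType d}.
Variable P : probability T R.
Implicit Types (X Y : {RV P >-> R}) (L : seq R) (A : set T).

Definition prob A : R := fine (P A).

Lemma EFin_prob A : measurable A -> P A = (prob A)%:E.
Proof. by move=> mA; rewrite /prob fineK// fin_num_measure. Qed.

Lemma prob_ge0 A : 0 <= prob A.
Proof. exact: fine_ge0. Qed.

Lemma prob_setT : prob setT = 1.
Proof. by rewrite /prob probability_setT. Qed.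

Lemma prob_set0 : prob set0 = 0.
Proof. by rewrite /prob measure0. Qed.

Lemma probU A A' : measurable A -> measurable A' -> A `&` A' = set0 ->
  prob (A `|` A') = prob A + prob A'.
Proof.
move=> mA mA' AA'; rewrite {1}/prob measureU//.
by rewrite fineD ?fin_num_measure.
Qed.

Lemma le_prob A A' : measurable A -> measurable A' -> A `<=` A' ->
  prob A <= prob A'.
Proof.
by move=> mA mA' ?; rewrite -lee_fin -!EFin_prob// le_measure// inE.
Qed.

Lemma measurable_level X v : measurable [set w | X w = v].
Proof. exact: (measurable_funPTI X (measurable_set1 v)). Qed.

Lemma measurable_deviation X (s t : R) : measurable [set w | `|X w - s| <= t].
Proof.
rewrite (_ : mkset _ = X @^-1` `[s - t, s + t]%classic).
  exact: measurable_funPTI.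
by apply/seteqP; split=> w; rewrite /= in_itv/= ler_distl.
Qed.

Lemma measurable_notin X L : measurable [set w | X w \notin L].
Proof.
elim: L => [|v L mL].
  by rewrite (_ : mkset _ = setT)//; apply/seteqP; split=> w //=.
rewrite (_ : mkset _ = ~` [set w | X w = v] `&` [set w | X w \notin L]).
  by apply: measurableI => //; apply: measurableC; exact: measurable_level.
apply/seteqP; split=> w /=; rewrite inE negb_or.
  by move=> /andP[/eqP ? ?].
by move=> [/eqP ? ?]; apply/andP.
Qed.

(** The remainder outside [L] is kept, because for a newly rounded value it is only shown
    afterwards, by counting mass, that this remainder vanishes. *)
Lemma prob_split X L A : measurable A -> uniq L ->
  prob A = \sum_(v <- L) prob (A `&` [set w | X w = v])
         + prob (A `&` [set w | X w \notin L]).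
Proof.
move=> mA; elim: L => [_|v L IH /= /andP[vL uL]].
  rewrite big_nil add0r; congr prob; apply/seteqP; split=> w //=.
  by case.
rewrite big_cons IH// addrAC [RHS]addrC; congr (_ + _); rewrite addrC.
have mv := measurable_level X v; have mL := measurable_notin X (v :: L).
rewrite -probU; [|exact: measurableI|exact: measurableI|].
  congr prob; apply/seteqP; split=> w /=.
    move=> [Aw wL]; have [->|vw] := eqVneq (X w) v; [by right|left].
    by rewrite inE negb_or vw.
  move=> [] [Aw]; first by rewrite inE negb_or => /andP[].
  by move=> ->.
apply/seteqP; split=> w //= [] [_]; rewrite inE negb_or => /andP[/eqP + _].
by move=> + [_].
Qed.

(** The support is confined to [L] almost surely only, as the rounding hypothesis speaks of
    probabilities and leaves null events free. *)
Definition finite_law X L := uniq L /\ prob [set w | X w \notin L] = 0.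

Lemma prob_finite_law X L A : measurable A -> finite_law X L ->
  prob A = \sum_(v <- L) prob (A `&` [set w | X w = v]).
Proof.
move=> mA [uL PL]; rewrite (prob_split X mA uL) [X in _ + X](_ : _ = 0) ?addr0//.
apply/eqP; rewrite eq_le prob_ge0 andbT -PL.
have mL := measurable_notin X L.
exact: le_prob (measurableI _ _ mA mL) mL (@subIsetr _ _ _).
Qed.

Lemma sum_finite_law X L : finite_law X L ->
  \sum_(v <- L) prob [set w | X w = v] = 1.
Proof.
move=> XL; rewrite -prob_setT (prob_finite_law measurableT XL).
by under [RHS]eq_bigr do rewrite setTI.
Qed.

Lemma finite_lawP X L : uniq L ->
  \sum_(v <- L) prob [set w | X w = v] = 1 -> finite_law X L.
Proof.
move=> uL sL; split=> //; have := prob_split X measurableT uL.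
under eq_bigr do rewrite setTI.
by rewrite sL prob_setT setTI -[LHS]addr0 => /addrI.
Qed.

(** Compared value by value: the event [X = v] lies inside the deviation event and contributes
    nothing to the complement, or it lies outside and then [t ^ 2 <= (v - s) ^ 2]. *)
Lemma chebyshev_finite_law X L s V t : 0 < t -> finite_law X L ->
  \sum_(v <- L) (v - s) ^+ 2 * prob [set w | X w = v] <= V ->
  1 - V / t ^+ 2 <= prob [set w | `|X w - s| <= t].
Proof.
move=> t0 XL hV; set E := mkset _.
have mE : measurable E by exact: measurable_deviation.
have t2 : 0 < t ^+ 2 by rewrite exprn_gt0.
rewrite lerBlDl -(sum_finite_law XL) (prob_finite_law mE XL).
rewrite -lerBlDr -sumrB ler_pdivlMr// mulr_suml.
apply: le_trans hV; apply: ler_sum => v _.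
have [vt|vt] := leP `|v - s| t.
  rewrite [X in _ - X](_ : _ = prob [set w | X w = v]).
    by rewrite subrr mul0r mulr_ge0 ?sqr_ge0 ?prob_ge0.
  congr prob; apply/seteqP; split=> w /=; first by case.
  by move=> wv; split=> //; rewrite /E/= wv.
rewrite [X in _ - X](_ : _ = 0).
  rewrite subr0 mulrC ler_wpM2r ?prob_ge0// -(real_normK (num_real (v - s))).
  by rewrite lerXn2r ?nnegrE ?ltW// (lt_trans t0).
rewrite -prob_set0; congr prob; apply/seteqP; split=> w //= -[+ wv].
by rewrite /E/= wv leNgt vt.
Qed.

(** Transition law: given [Y = y], [X] is the stochastic rounding of [f y]. The product form also
    covers values [y] of probability zero. *)
Definition sr_law (beta p : nat) (f : R -> R) Y X : Prop := forall y v,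
  prob ([set w | Y w = y] `&` [set w | X w = v]) =
  sr_mass beta p (f y) v * prob [set w | Y w = y].

Lemma finite_law_sr (beta p : nat) (f : R -> R) Y X L :
  finite_law Y L -> sr_law beta p f Y X ->
  exists2 L', finite_law X L' &
    forall g : R -> R, \sum_(v <- L') g v * prob [set w | X w = v] =
      \sum_(y <- L) sr_mean beta p (f y) g * prob [set w | Y w = y].
Proof.
move=> YL hlaw.
pose L' := undup (flatten
  [seq [:: f y; float_up beta p (f y); float_down beta p (f y)] | y <- L]).
have uL' : uniq L' by exact: undup_uniq.
have expectation g : \sum_(v <- L') g v * prob [set w | X w = v] =
      \sum_(y <- L) sr_mean beta p (f y) g * prob [set w | Y w = y].
  under eq_bigr => v _.
    rewrite (prob_finite_law (measurable_level X v) YL) mulr_sumr.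
    under eq_bigr do rewrite setIC hlaw mulrA [g v * _]mulrC.
    over.
  rewrite exchange_big/=; apply: eq_big_seq => y yL.
  rewrite -mulr_suml sum_sr_mass// => z zy; rewrite mem_undup.
  apply/flattenP; eexists; last exact: zy.
  by apply/mapP; exists y.
exists L' => //; apply: finite_lawP => //.
(* Taking [g = 1] shows that [L'] carries total mass 1, hence supports [X]. *)
have := expectation (fun=> 1); under eq_bigr do rewrite mul1r.
move=> ->; under eq_bigr do rewrite sr_mean_cst mul1r.
exact: sum_finite_law.
Qed.

(** Mean [s] and variance at most [V]; the support is hidden because it changes at each rounding. *)
Definition moments_bounded X s V := exists L, [/\ finite_law X L,
  \sum_(v <- L) (v - s) * prob [set w | X w = v] = 0 &
  \sum_(v <- L) (v - s) ^+ 2 * prob [set w | X w = v] <= V].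

(** Law of total variance for an affine [f] of slope [q]: the error of [Y] is scaled by [q], and the
    rounding adds at most [u ^ 2] times the second moment of [f Y]. *)
Lemma moments_bounded_sr (beta p : nat) (f : R -> R) Y X (q s V : R) :
  (2 <= beta)%N -> (1 <= p)%N ->
  (forall y, f y - f s = q * (y - s)) -> sr_law beta p f Y X ->
  moments_bounded Y s V ->
  moments_bounded X (f s) ((1 + roundoff beta p ^+ 2) * (q ^+ 2 * V)
                           + roundoff beta p ^+ 2 * f s ^+ 2).
Proof.
move=> hbeta hp hf hlaw [L [YL mean var]].
have [L' XL' expectation] := finite_law_sr YL hlaw.
exists L'; split=> //.
  rewrite (expectation (fun v => v - f s)).
  under eq_bigr do rewrite sr_mean_sub// hf -mulrA.
  by rewrite -mulr_sumr mean mulr0.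
rewrite (expectation (fun v => (v - f s) ^+ 2)).
set u2 := roundoff beta p ^+ 2.
have u2_ge0 : 0 <= u2 by rewrite sqr_ge0.
pose pY y := prob [set w | Y w = y].
(* [f y ^ 2] is expanded around [f s]; the cross term is linear in [y - s] and averages to zero. *)
apply: le_trans (_ : \sum_(y <- L) ((1 + u2) * q ^+ 2 * ((y - s) ^+ 2 * pY y)
   + 2 * u2 * q * f s * ((y - s) * pY y) + u2 * f s ^+ 2 * pY y) <= _).
  apply: ler_sum => y _.
  apply: le_trans (ler_wpM2r (prob_ge0 _) (sr_mean_sqr_sub hbeta hp _ _)) _.
  have -> : f y = q * (y - s) + f s by rewrite -hf subrK.
  by rewrite le_eqVlt; apply/orP; left; apply/eqP; rewrite -/u2 /pY; ring.
rewrite !big_split/= -!mulr_sumr mean mulr0 addr0 (sum_finite_law YL) mulr1.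
by rewrite lerD2r mulrA ler_wpM2l// mulr_ge0 ?sqr_ge0// addr_ge0.
Qed.

(* The values [X i] with [i < j] are summed out one at a time;
   each sum is finite. *)
Lemma forget_history (X : nat -> {RV P >-> R}) k A (m : (nat -> R) -> R) :
  measurable A -> (forall j, (j < k)%N -> exists L, finite_law (X j) L) ->
  (forall h h', h k.-1 = h' k.-1 -> m h = m h') ->
  (forall h, prob ([set w | forall i, (i < k)%N -> X i w = h i] `&` A) =
     m h * prob [set w | forall i, (i < k)%N -> X i w = h i]) ->
  forall j, (j < k)%N -> forall h,
  prob ([set w | forall i, (j <= i < k)%N -> X i w = h i] `&` A) =
  m h * prob [set w | forall i, (j <= i < k)%N -> X i w = h i].
Proof.
move=> mA hL hm h0; elim=> [_ h|j IH jk h]; first exact: h0.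
have [L XL] := hL j (ltnW jk).
have mH (h' : nat -> R) i0 :
    measurable [set w | forall i, (i0 <= i < k)%N -> X i w = h' i].
  rewrite (_ : mkset _ =
    \bigcap_(i in [set i | (i0 <= i < k)%N]) [set w | X i w = h' i]) //.
  by apply: bigcap_measurableType => i _; exact: measurable_level.
(* Fixing [X j = z] turns the shorter history into one starting at [j], to which the induction
   hypothesis applies. *)
pose h' z i := if i == j then z else h i.
have cut z : [set w | forall i, (j < i < k)%N -> X i w = h i]
      `&` [set w | X j w = z] =
    [set w | forall i, (j <= i < k)%N -> X i w = h' z i].
  apply/seteqP; split=> w /=.
    move=> [hw jz] i /andP[ji ik]; rewrite /h'; case: eqVneq => [->//|ij].
    by apply: hw; rewrite ltn_neqAle eq_sym ij ji.
  move=> hw; split=> [i /andP[ji ik]|].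
    by rewrite hw ?(ltnW ji)// /h' gtn_eqF.
  by rewrite hw ?leqnn ?(ltnW jk)// /h' eqxx.
rewrite (prob_finite_law (mH _ _) XL) mulr_sumr.
rewrite (prob_finite_law (measurableI _ _ (mH _ _) mA) XL).
apply: eq_bigr => z _; rewrite setIAC cut IH ?(ltnW jk)//; congr (_ * _).
(* The changed index [j] is below [k.-1], the only index on which [m] depends. *)
by apply: hm; rewrite /h' gtn_eqF// -ltnS prednK// (leq_trans _ jk).
Qed.

End FiniteLaws.

(** * Exact Horner recursion and its majorant with absolute values *)

Section HornerValue.
Context {R : realType}.
Implicit Types (a : nat -> R) (x y : R).

Definition horner_step n a x k y : R :=
  if odd k then y * x else y + a (n - k./2)%N.

Fixpoint horner_value n a x k : R :=
  if k is k'.+1 then horner_step n a x k (horner_value n a x k') else a n.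

(** At [k = n] this yields both [P(x)] and, for the data [|a i|] and [|x|], the numerator of the
    condition number. *)
Lemma horner_valueE n a x k : (k <= n)%N ->
  horner_value n a x (2 * k) = \sum_(i < k.+1) a (n - k + i)%N * x ^+ i.
Proof.
elim: k => [_|k IH kn].
  by rewrite big_ord1 muln0 subn0 addn0 expr0 mulr1.
rewrite mulnS add2n /= /horner_step /= mul2n odd_double/= doubleK -mul2n.
rewrite IH 1?ltnW// [RHS]big_ord_recl/= addn0 expr0 mulr1 addrC; congr (_ + _).
rewrite mulr_suml; apply: eq_bigr => i _; rewrite -mulrA -exprSr.
by rewrite /bump/= add1n addnS -addSn -subSn.
Qed.

Lemma norm_horner_value n a x k :
  `|horner_value n a x k| <= horner_value n (fun i => `|a i|) `|x| k.
Proof.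
elim: k => //= k IH; rewrite /horner_step; case: ifP => _.
  by rewrite normrM ler_wpM2r.
by rewrite (le_trans (ler_normD _ _))// lerD2r.
Qed.

Lemma horner_stepB n a x k y z :
  horner_step n a x k y - horner_step n a x k z
  = (if odd k then x else 1) * (y - z).
Proof. by rewrite /horner_step; case: ifP => _; ring. Qed.

(** A product scales the majorant by exactly [|x|], and an addition only increases it. This absorbs
    the slope of each step in the variance recursion. *)
Lemma sqr_horner_value_le n a x k :
  (if odd k.+1 then x else 1) ^+ 2 *
    horner_value n (fun i => `|a i|) `|x| k ^+ 2
  <= horner_value n (fun i => `|a i|) `|x| k.+1 ^+ 2.
Proof.
have S_ge0 : 0 <= horner_value n (fun i => `|a i|) `|x| k.
  exact: le_trans (norm_horner_value n a x k).
rewrite /= /horner_step -[odd k.+1]/(~~ odd k); case: ifP => _.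
  by rewrite exprMn real_normK ?num_real// mulrC.
by rewrite expr1n mul1r lerXn2r ?nnegrE ?addr_ge0// lerDl.
Qed.

End HornerValue.

(** * Mean and variance of the computed Horner values *)

Lemma horner_moments (R : realType) (d : measure_display)
    (T : measurableType d) (P : probability T R) (beta p n : nat)
    (a : nat -> R) (x : R) (r delta : nat -> {RV P >-> R}) :
  (2 <= beta)%N -> (1 <= p)%N -> (forall w, r 0%N w = a n) ->
  (forall k, (1 <= k <= 2 * n)%N -> forall w,
     r k w = horner_exact n a x (fun j v => r j v) k w * (1 + delta k w)) ->
  SR_nearness_errors P beta p (2 * n)
    (horner_exact n a x (fun k w => r k w)) (fun k w => delta k w) ->
  forall k, (k <= 2 * n)%N ->
  moments_bounded (r k) (horner_value n a x k)
    (horner_value n (fun i => `|a i|) `|x| k ^+ 2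
     * gamma_ k (roundoff beta p ^+ 2)).
Proof.
move=> hbeta hp hr0 hr hSR; set u2 := roundoff beta p ^+ 2.
have u2_ge0 : 0 <= u2 by rewrite sqr_ge0.
(* Strong induction: summing out the history uses the finite laws of all earlier values. *)
elim/ltn_ind => -[_ _|k IH kn].
  exists [:: a n]; split.
  - split=> //; rewrite (_ : mkset _ = set0) ?prob_set0//.
    by apply/seteqP; split=> w //=; rewrite hr0 inE eqxx.
  - by rewrite big_seq1 subrr mul0r.
  - by rewrite big_seq1 subrr expr0n mul0r /gamma_ expr0 subrr mulr0.
set f := horner_step n a x k.+1.
(* Markov property: given the whole history, the law of [r k.+1] depends on [h k] alone, so the
   earlier values can be forgotten. *)
have law : sr_law beta p f (r k) (r k.+1).
  move=> y v; have [_ hk] := hSR k.+1 kn.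
  pose m (h : nat -> R) := sr_mass beta p (f (h k)) v.
  have := @forget_history _ _ _ P r k.+1 [set w | r k.+1 w = v] m
    (measurable_level _ _) _ _ _ k (ltnSn k) (fun=> y).
  rewrite (_ : [set w | forall i, _] = [set w | r k w = y]); last first.
    apply/seteqP; split=> w /= hw; first by apply: hw; rewrite leqnn /=.
    by move=> i /andP[ki]; rewrite ltnS => ik; rewrite (_ : i = k)//;
      apply/eqP; rewrite eqn_leq ik.
  apply.
  - move=> j jk; have [|L [XL _ _]] := IH j jk; last by exists L.
    by rewrite ltnW// (leq_trans jk).
  - by move=> h h' /= hh; rewrite /m hh.
  (* The rounding hypothesis records values from index 1, the history here from index 0; as [r 0] is
     constant, any other [h 0] gives the empty event. *)
  move=> h; have [h0|h0] := eqVneq (h 0%N) (a n); last first.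
    rewrite (_ : [set w | forall i, _] = set0).
      by rewrite set0I prob_set0 mulr0.
    apply/seteqP; split=> w //= /(_ _ (ltn0Sn k)).
    by rewrite hr0 => /esym/eqP; rewrite (negPf h0).
  have flE j w : (1 <= j <= k.+1)%N ->
      horner_exact n a x (fun j v => r j v) j w * (1 + delta j w) = r j w.
    move=> /andP[j1 jk]; rewrite hr// j1 (leq_trans jk)//.
  (* With [y = f (h k)] the condition on the exact result already follows from the history. *)
  have := hk h (f (h k)) v => /(congr1 fine).
  rewrite (_ : [set w | _ /\ _] =
    [set w | forall i, (i < k.+1)%N -> r i w = h i]).
    rewrite (_ : [set w | _ = v] = [set w | r k.+1 w = v]).
      rewrite -/(prob _ _) => ->; rewrite fineM// fin_num_measure//.
      rewrite (_ : mkset _ = \bigcap_(i in [set i | (i < k.+1)%N])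
        [set w | r i w = h i])//.
      by apply: bigcap_measurableType => i _; exact: measurable_level.
    by apply/seteqP; split=> w /=; rewrite flE ?leqnn.
  have exactE w : horner_exact n a x (fun j v => r j v) k.+1 w = f (r k w).
    by rewrite /horner_exact subn1.
  apply/seteqP; split=> w /=.
    move=> [hw _] [_|i ik]; first by rewrite hr0.
    by rewrite -hw// flE// (ltnW ik).
  move=> hw; split; last by rewrite exactE hw.
  by move=> j /andP[j1 jk]; rewrite flE ?j1 ?(ltnW jk)//; exact: hw.
have [L [XL mean var]] :=
  moments_bounded_sr hbeta hp (horner_stepB n a x k.+1 ^~ _) law
    (IH k (ltnSn k) (ltnW kn)).
exists L; split=> //; apply: le_trans var _.
rewrite -/u2.
set q := (if odd k.+1 then x else 1).
set S := horner_value _ (fun i => `|a i|) _.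
have hS : q ^+ 2 * S k ^+ 2 <= S k.+1 ^+ 2 := sqr_horner_value_le n a x k.
have hs : f (horner_value n a x k) ^+ 2 <= S k.+1 ^+ 2.
  have hn := norm_horner_value n a x k.+1.
  rewrite -real_normK ?num_real// lerXn2r ?nnegrE//.
  exact: le_trans (normr_ge0 _) hn.
have g_ge0 : 0 <= gamma_ k u2 by rewrite subr_ge0 exprn_ege1// lerDl.
(* Both [q ^ 2 * S k ^ 2] and the squared exact value are replaced by [S k.+1 ^ 2]; then [(1 + u2) *
   gamma_ k u2 + u2 = gamma_ k.+1 u2]. *)
apply: le_trans (_ : (1 + u2) * S k.+1 ^+ 2 * gamma_ k u2
                     + u2 * S k.+1 ^+ 2 <= _).
  apply: lerD; last exact: ler_wpM2l.
  by rewrite -[leRHS]mulrA ler_wpM2l ?addr_ge0// [leLHS]mulrA ler_wpM2r.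
by rewrite /gamma_ [(1 + u2) ^+ k.+1]exprS le_eqVlt; apply/orP; left;
   apply/eqP; ring.
Qed.

(** * Probabilistic error bound for Horner's rule *)

Theorem mainTheorem6 (R : realType) (d : measure_display)
    (T : measurableType d) (P : probability T R)
    (beta p : nat) (hbeta : (2 <= beta)%N) (hp : (1 <= p)%N)
    (n : nat) (hn : (1 <= n)%N) (a : nat -> R) (x : R)
    (hPx : \sum_(i < n.+1) a i * x ^+ i != 0)
    (r delta : nat -> {RV P >-> R})
    (hr0 : forall w, r 0%N w = a n)
    (hmul : forall k, (1 <= k <= n)%N -> forall w,
       r (2 * k - 1)%N w
       = r (2 * k - 2)%N w * x * (1 + delta (2 * k - 1)%N w))
    (hadd : forall k, (1 <= k <= n)%N -> forall w,
       r (2 * k)%N w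
       = (r (2 * k - 1)%N w + a (n - k)%N) * (1 + delta (2 * k)%N w))
    (hSR : SR_nearness_errors P beta p (2 * n)
             (horner_exact n a x (fun k w => r k w)) (fun k w => delta k w))
    (lambda : R) (hlambda : 0 < lambda < 1) :
  let Px : R := \sum_(i < n.+1) a i * x ^+ i in
  let K1 : R := (\sum_(i < n.+1) `|a i * x ^+ i|) / `|Px| in
  let u : R := roundoff beta p in
  let E := [set w | `|r (2 * n)%N w - Px| / `|Px|
                    <= K1 * Num.sqrt (gamma_ (2 * n) (u ^+ 2) / lambda)] in
  ((1 - lambda)%:E <= P E)%E.
Proof.
have /andP[l0 l1] := hlambda; cbv zeta.
set Px := \sum_(i < n.+1) a i * x ^+ i in hPx *; set u := roundoff beta p.
set E := [set w | _ <= _].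
(* The two recurrences are merged into one indexed by the operation, split by parity. *)
have hr k : (1 <= k <= 2 * n)%N -> forall w,
    r k w = horner_exact n a x (fun j v => r j v) k w * (1 + delta k w).
  rewrite /horner_exact.
  have [m [->|->]] : exists m, k = (2 * m)%N \/ k = (2 * m).+1.
    exists k./2; have := odd_double_half k; rewrite -mul2n.
    by case: (odd k) => /esym kE; [right|left]; exact: kE.
  - rewrite mul2n odd_double doubleK -mul2n muln_gt0 leq_pmul2l//= => mn w.
    by rewrite hadd// subn1.
  - rewrite mul2n /= odd_double/= subn1/= -mul2n => mn w.
    have := hmul m.+1; rewrite mulnS add2n subn1 subn2/=; apply.
    by rewrite -(ltn_pmul2l (isT : 0 < 2)%N).
have [L [XL _ var]] := horner_moments hbeta hp hr0 hr hSR (leqnn _).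
rewrite !horner_valueE// subnn in XL var.
set S := \sum_(i < n.+1) `|a i * x ^+ i|.
have SE : \sum_(i < n.+1) `|a (0 + i)%N| * `|x| ^+ i = S.
  by apply: eq_bigr => i _; rewrite add0n normrM normrX.
rewrite SE in var.
have Px_gt0 : 0 < `|Px| by rewrite normr_gt0.
have S_gt0 : 0 < S by apply: lt_le_trans Px_gt0 _; exact: ler_norm_sum.
set G := gamma_ (2 * n) (u ^+ 2) in var *.
have G_gt0 : 0 < G.
  rewrite subr_gt0 exprn_egt1 ?muln_eq0 -?lt0n ?hn//.
  by rewrite ltrDl exprn_gt0// roundoff_gt0.
have Gl : 0 < G / lambda by rewrite divr_gt0.
(* With this threshold [t] and the variance bound [S ^ 2 * G], Chebyshev's ratio is exactly
   [lambda]. *)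
have t_gt0 : 0 < S * Num.sqrt (G / lambda) by rewrite mulr_gt0// sqrtr_gt0.
have := chebyshev_finite_law t_gt0 XL var.
rewrite exprMn sqr_sqrtr ?(ltW Gl)//.
rewrite (_ : _ / _ = lambda); last by field; rewrite !gt_eqF.
have -> : \sum_(i < n.+1) a (0 + i)%N * x ^+ i = Px by [].
have <- : [set w | `|r (2 * n)%N w - Px| <= S * Num.sqrt (G / lambda)] = E.
  apply/seteqP; split=> w; rewrite /E /= -/S -/G;
    by rewrite mulrAC ler_pM2r ?invr_gt0.
by rewrite -lee_fin -EFin_prob//; exact: measurable_deviation.
Qed.
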